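(* Let $k\ge 2$ be an integer. The power series $$\Pi_{k,1}(\phi)=\sum_{n=1}^\infty \frac{(-1)^n H_{n,1}}{(n+1)^k}\,\phi^{n+1}$$ is a solution of the differential operator $$\mathscr{D}_{k,1}=(1+\phi)^2\vartheta^{k+2}-3(1+\phi)\vartheta^{k+1}+(2+\phi)\vartheta^k,\qquad \vartheta=\phi\frac{d}{d\phi},$$ i.e. $\mathscr{D}_{k,1}\,\Pi_{k,1}=0$ (on the open unit disc $|\phi|<1$).
   Context: $H_{n,1}=\sum_{m=1}^n \frac1m$ is the $n$-th harmonic number. $\vartheta^j$ denotes the $j$-fold iterate of the operator $\vartheta=\phi\, d/d\phi$. *)

(* Defs.v *)
From Stdlib Require Import Reals.
From Coquelicot Require Export Coquelicot.

Local Open Scope R_scope.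

Definition harmonic (n : nat) : R := sum_n_m (fun m : nat => / INR m) 1 n.

Definition Pi_term (k : nat) (phi : C) (n : nat) : C :=
  (RtoC ((-1) ^ n * harmonic n / (INR (n + 1)) ^ k) * phi ^ (n + 1)%nat)%C.

(* [is_series] indexes from 0; [S i] makes the sum start at n = 1. *)
Definition Pi_series_term (k : nat) (phi : C) : nat -> C :=
  fun i : nat => Pi_term k phi (S i).

(* [iota] is a total choice operator: it returns the sum where the series
   converges, and an unspecified value elsewhere. *)
Definition Pi_k1 (k : nat) (phi : C) : C :=
  @iota C_CompleteNormedModule
    (fun s : C => @is_series C_AbsRing C_NormedModule (Pi_series_term k phi) s).

(* [C_derive] is total, and is the complex derivative wherever
   [ex_derive] over [C_AbsRing] holds ([C_derive_correct]). *)
Definition theta (f : C -> C) : C -> C :=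
  fun phi : C => (phi * C_derive f phi)%C.

Definition theta_iter (j : nat) (f : C -> C) : C -> C := Nat.iter j theta f.

Definition D_k1 (k : nat) (f : C -> C) : C -> C :=
  fun phi : C =>
    ((1 + phi) ^ 2 * theta_iter (k + 2) f phi
     - 3 * (1 + phi) * theta_iter (k + 1) f phi
     + (2 + phi) * theta_iter k f phi)%C.

(* Main.v *)
(* On power series, theta multiplies the n-th coefficient by n, so theta^k
   turns Pi_{k,1} into the sum of (-1)^(n-1) H_{n-1} phi^n, and the equation
   becomes a three-term recurrence for the harmonic numbers.  Complex termwise
   differentiation rests on the estimate
     r^2 |w^n - z^n - (w - z) n z^(n-1)| <= |w - z|^2 n^2 r^n   (|w|, |z| <= r),
   whose right-hand side is summable against a_n when r is less than the radius
   of convergence. *)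
Require Import Defs.
From Stdlib Require Import Reals Lra Lia.
From Coquelicot Require Import Coquelicot.

Local Open Scope R_scope.

(** * Sums of complex series *)

Notation is_Cseries := (@is_series C_AbsRing C_NormedModule).

(* Coquelicot's generic operations hide the carrier [C] from [ring]. *)
Ltac Cring :=
  unfold plus, opp, scal; simpl; unfold mult, zero; simpl;
  lazymatch goal with |- @eq _ ?x ?y => change (@eq C x y) end; ring.

Lemma is_Cseries_unique (u : nat -> C) (s t : C) :
  is_Cseries u s -> is_Cseries u t -> s = t.
Proof. apply filterlim_locally_unique. Qed.

(** The triangle inequality gives the bound for partial sums; continuity of the norm carries it to
    the limit. *)
Lemma is_Cseries_norm_le (u : nat -> C) (b : nat -> R) (s : C) (t : R) :
  (forall n, Cmod (u n) <= b n) -> is_Cseries u s -> is_series b t ->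
  Cmod s <= t.
Proof.
  intros Hub Hu Hb.
  apply (is_lim_seq_le (fun n => Cmod (@sum_n C_AbelianMonoid u n)) (sum_n b)
           (Cmod s) t); [| |exact Hb].
  - intros n.
    apply Rle_trans with (sum_n (fun k => Cmod (u k)) n).
    + exact (@norm_sum_n_m C_AbsRing C_NormedModule u 0 n).
    + now apply sum_n_m_le.
  - exact (filterlim_comp _ _ _ _ (@norm C_AbsRing C_NormedModule) _ _ _ Hu
             (@filterlim_norm C_AbsRing C_NormedModule s)).
Qed.

(** * Power series with real coefficients in a complex variable *)

(** Keeping the coefficients real makes the real theory of [CV_radius] applicable. *)
Definition is_Cpseries (a : nat -> R) (z s : C) : Prop :=
  is_Cseries (fun n => RtoC (a n) * z ^ n)%C s.

Lemma is_Cpseries_incr_1 (a : nat -> R) (z s : C) :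
  is_Cpseries a z s -> is_Cpseries (PS_incr_1 a) z (z * s)%C.
Proof.
  intros H; apply is_series_decr_1.
  match goal with |- is_series _ ?l => replace l with (z * s)%C end.
  - eapply is_series_ext; [|exact (is_series_scal z _ s H)].
    intros n; Cring.
  - Cring.
Qed.

Lemma is_Cpseries_plus (a b : nat -> R) (z s t : C) :
  is_Cpseries a z s -> is_Cpseries b z t ->
  is_Cpseries (fun n => a n + b n) z (s + t)%C.
Proof.
  intros Ha Hb; eapply is_series_ext; [|exact (is_series_plus _ _ _ _ Ha Hb)].
  intros n; rewrite RtoC_plus; Cring.
Qed.

Lemma is_Cpseries_scal (c : R) (a : nat -> R) (z s : C) :
  is_Cpseries a z s -> is_Cpseries (fun n => c * a n) z (RtoC c * s)%C.
Proof.
  intros Ha; eapply is_series_ext; [|exact (is_series_scal (RtoC c) _ _ Ha)].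
  intros n; rewrite RtoC_mult; Cring.
Qed.

Lemma is_Cpseries_0 (a : nat -> R) (z s : C) :
  (forall n, a n = 0) -> is_Cpseries a z s -> s = RtoC 0.
Proof.
  intros Ha Hs.
  assert (H := is_series_scal (RtoC 0) _ _ Hs).
  apply (is_Cseries_unique _ _ _ Hs).
  replace (RtoC 0) with (RtoC 0 * s)%C by ring.
  eapply is_series_ext; [|exact H].
  intros n; rewrite Ha; Cring.
Qed.

Lemma ex_Cpseries (a : nat -> R) (z : C) :
  Rbar_lt (Cmod z) (CV_radius a) -> exists s, is_Cpseries a z s.
Proof.
  intros Hz.
  apply (@ex_series_le C_AbsRing C_CompleteNormedModule _
           (fun n => Rabs (a n * Cmod z ^ n))).
  - intros n; change (Cmod (RtoC (a n) * z ^ n)%C <= Rabs (a n * Cmod z ^ n)).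
    rewrite Cmod_mult, Cmod_R, Cmod_pow, Rabs_mult.
    rewrite (Rabs_pos_eq (Cmod z ^ n)); [lra|apply pow_le, Cmod_ge_0].
  - apply CV_disk_inside; now rewrite Rabs_pos_eq by apply Cmod_ge_0.
Qed.

(** * Termwise complex differentiation and the Euler operator *)

(** The remainders satisfy [E_(n+1) = w E_n + n (w - z)^2 z^(n-1)], and [n^2 + n <= (n+1)^2] closes
    the induction. The factor [r^2] avoids the exponent [n - 2]. *)
Lemma pow_taylor1_bound (w z : C) (r : R) (n : nat) :
  Cmod w <= r -> Cmod z <= r ->
  r ^ 2 * Cmod (w ^ n - z ^ n - (w - z) * (RtoC (INR n) * z ^ pred n))%C
  <= Cmod (w - z)%C ^ 2 * (INR n ^ 2 * r ^ n).
Proof.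
  intros Hw Hz.
  assert (Hr : 0 <= r) by (apply Rle_trans with (1 := Cmod_ge_0 w); exact Hw).
  induction n as [|n IH].
  - simpl; replace (1 - 1 - (w - z) * (0 * 1))%C with (RtoC 0) by ring.
    rewrite Cmod_0; lra.
  (* The recursion contains [z^(n-1)], so it starts from [n = 1], where the remainder is zero. *)
  - destruct n as [|m].
    + simpl; replace (w * 1 - z * 1 - (w - z) * (1 * 1))%C with (RtoC 0) by ring.
      rewrite Cmod_0; assert (H := pow2_ge_0 (Cmod (w - z))); simpl in H; nra.
    + set (E := (w ^ S m - z ^ S m - (w - z) * (RtoC (INR (S m)) * z ^ pred (S m)))%C) in *.
      replace (w ^ S (S m) - z ^ S (S m)
               - (w - z) * (RtoC (INR (S (S m))) * z ^ pred (S (S m))))%C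
        with (w * E + RtoC (INR (S m)) * ((w - z) ^ 2 * z ^ m))%C
        by (unfold E; rewrite (S_INR (S m)), RtoC_plus; simpl; ring).
      assert (HE : Cmod (w * E) <= r * Cmod E).
      { rewrite Cmod_mult; apply Rmult_le_compat_r; [apply Cmod_ge_0|exact Hw]. }
      assert (HF : Cmod (RtoC (INR (S m)) * ((w - z) ^ 2 * z ^ m))%C
                   <= INR (S m) * (Cmod (w - z)%C ^ 2 * r ^ m)).
      { rewrite !Cmod_mult, !Cmod_pow, Cmod_R, Rabs_pos_eq by apply pos_INR.
        apply Rmult_le_compat_l; [apply pos_INR|].
        apply Rmult_le_compat_l; [apply pow2_ge_0|].
        apply pow_incr; split; [apply Cmod_ge_0|exact Hz]. }
      assert (HT := Cmod_triangle (w * E) (RtoC (INR (S m)) * ((w - z) ^ 2 * z ^ m))).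
      assert (Hn : 0 <= INR (S m)) by apply pos_INR.
      rewrite (S_INR (S m)); set (N := INR (S m)) in *.
      set (d := Cmod (w - z)%C) in *.
      assert (HP : 0 <= d ^ 2 * r ^ S (S m)).
      { apply Rmult_le_pos; [apply pow2_ge_0|now apply pow_le]. }
      apply Rle_trans with (r ^ 2 * (r * Cmod E + N * (d ^ 2 * r ^ m))).
      { apply Rmult_le_compat_l; [apply pow2_ge_0|lra]. }
      apply (Rmult_le_compat_l r) in IH; [|exact Hr].
      simpl in IH, HP |- *; nra.
Qed.

Lemma Rbar_lt_dense (x : R) (y : Rbar) :
  Rbar_lt x y -> exists r : R, x < r /\ Rbar_lt r y.
Proof.
  destruct y as [y| |]; simpl; intros H; [|exists (x + 1)|easy].
  - exists ((x + y) / 2); lra.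
  - split; [lra|easy].
Qed.

Definition euler_coeff (a : nat -> R) (n : nat) : R := INR n * a n.

Lemma euler_coeff_incr_derive (a : nat -> R) (n : nat) :
  PS_incr_1 (PS_derive a) n = euler_coeff a n.
Proof.
  unfold euler_coeff; destruct n; [simpl; unfold zero; simpl; ring|reflexivity].
Qed.

(** The sequence is a derivative followed by a shift, and both preserve the radius. *)
Lemma CV_radius_euler (a : nat -> R) : CV_radius (euler_coeff a) = CV_radius a.
Proof.
  rewrite <- (CV_radius_derive a), <- (CV_radius_incr_1 (PS_derive a)).
  apply CV_radius_ext; intros n; symmetry; apply euler_coeff_incr_derive.
Qed.

(** [f] is left free outside the open disc of convergence, where [Pi_k1] may be unspecified. *)
Definition is_Cpseries_fun (a : nat -> R) (f : C -> C) : Prop :=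
  forall z : C, Rbar_lt (Cmod z) (CV_radius a) -> is_Cpseries a z (f z).

(** Summing the remainder bounds gives a first-order error of at most [M |w - z|^2 / r^2], which is
    [o(|w - z|)]. *)
Lemma is_derive_Cpseries (a : nat -> R) (f : C -> C) (z g : C) :
  is_Cpseries_fun a f -> Rbar_lt (Cmod z) (CV_radius a) ->
  is_Cpseries (PS_derive a) z g ->
  @is_derive C_AbsRing C_NormedModule f z g.
Proof.
  intros Hf Hz Hg.
  destruct (Rbar_lt_dense _ _ Hz) as [r [Hzr Hr]].
  assert (Hr0 : 0 < r) by (apply Rle_lt_trans with (1 := Cmod_ge_0 z); exact Hzr).
  (* Two applications of [euler_coeff] supply the weight [n^2] of the remainder bound. *)
  assert (HM : ex_series (fun n => Rabs (euler_coeff (euler_coeff a) n * r ^ n))).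
  { apply CV_disk_inside; rewrite !CV_radius_euler.
    now rewrite Rabs_pos_eq by lra. }
  destruct HM as [M HM].
  assert (Hest : forall w : C, Cmod w <= r ->
            Cmod (f w - f z - (w - z) * g)%C <= Cmod (w - z)%C ^ 2 / r ^ 2 * M).
  { intros w Hw.
    assert (Hwr : Rbar_lt (Cmod w) (CV_radius a)).
    { apply Rbar_le_lt_trans with (2 := Hr); exact Hw. }
    (* A zero term is put in front of the derivative series so that its index matches the exponent
       in the series for [f]. *)
    assert (Hg' : is_Cseries
              (fun n => RtoC (a n) * (RtoC (INR n) * z ^ pred n))%C g).
    { apply is_series_decr_1.
      match goal with |- is_series _ ?l => replace l with g end.
      - eapply is_series_ext; [|exact Hg].
        intros n; unfold PS_derive; rewrite RtoC_mult; Cring.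
      - Cring. }
    assert (H := is_series_plus _ _ _ _
                   (is_series_plus _ _ _ _ (Hf w Hwr)
                      (is_series_scal (RtoC (-1)) _ _ (Hf z Hz)))
                   (is_series_scal (- (w - z))%C _ _ Hg')).
    assert (HMs := is_series_scal (Cmod (w - z)%C ^ 2 / r ^ 2) _ _ HM).
    match type of H with is_series _ ?l =>
      replace (f w - f z - (w - z) * g)%C with l
        by (Cring)
    end.
    refine (is_Cseries_norm_le _ _ _ _ _ H HMs); intros n.
    match goal with |- Cmod ?u <= _ =>
      replace u with (RtoC (a n)
         * (w ^ n - z ^ n - (w - z) * (RtoC (INR n) * z ^ pred n)))%C
        by (Cring)
    end.
    rewrite Cmod_mult, Cmod_R; unfold scal; simpl; unfold mult; simpl.
    unfold euler_coeff; rewrite !Rabs_mult.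
    rewrite (Rabs_pos_eq (INR n)) by apply pos_INR.
    rewrite (Rabs_pos_eq (r ^ n)) by (apply pow_le; lra).
    assert (HB := pow_taylor1_bound w z r n Hw (Rlt_le _ _ Hzr)).
    set (e := Cmod (w ^ n - z ^ n - (w - z) * (RtoC (INR n) * z ^ pred n))) in *.
    set (d := Cmod (w - z)) in *.
    assert (He : e <= d ^ 2 * (INR n ^ 2 * r ^ n) / r ^ 2).
    { apply Rmult_le_reg_l with (r ^ 2); [nra|].
      apply Rle_trans with (1 := HB); right; field; lra. }
    apply Rle_trans with (Rabs (a n) * (d ^ 2 * (INR n ^ 2 * r ^ n) / r ^ 2)).
    - apply Rmult_le_compat_l; [apply Rabs_pos|exact He].
    - right; field; lra. }
  assert (HM0 := Rabs_pos M); assert (HMa := Rle_abs M).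
  split; [apply is_linear_scal_l|].
  (* Differentiability is stated at every limit [x] of the neighbourhood filter of [z]; the only one
     is [z]. *)
  intros x Hx.
  apply (is_filter_lim_locally_unique (V := AbsRing_NormedModule C_AbsRing)) in Hx.
  subst x; intros eps.
  (* The first bound forces [|w| <= r]; the second makes [|w - z| M / r^2 <= eps], with [Rabs M + 1]
     a nonzero bound on [M]. *)
  assert (Hd : 0 < Rmin (r - Cmod z) (eps * r ^ 2 / (Rabs M + 1))).
  { apply Rmin_case; [lra|].
    apply Rdiv_lt_0_compat; [|lra].
    apply Rmult_lt_0_compat; [apply cond_pos|nra]. }
  exists (mkposreal _ Hd); intros w Hw.
  assert (Hw' : Cmod (w - z)%C < Rmin (r - Cmod z) (eps * r ^ 2 / (Rabs M + 1)))
    by exact Hw.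
  change (Cmod (f w - f z - (w - z) * g)%C <= eps * Cmod (w - z)%C).
  assert (Hw1 := Rlt_le_trans _ _ _ Hw' (Rmin_l _ _)).
  assert (Hw2 := Rlt_le_trans _ _ _ Hw' (Rmin_r _ _)).
  apply Rle_trans with (Cmod (w - z)%C ^ 2 / r ^ 2 * M).
  - apply Hest.
    replace w with ((w - z) + z)%C by ring.
    apply Rle_trans with (1 := Cmod_triangle _ _); lra.
  - assert (Hc := Cmod_ge_0 (w - z)%C); set (d := Cmod (w - z)%C) in *.
    assert (Hd' : d * (Rabs M + 1) <= eps * r ^ 2).
    { apply Rmult_le_reg_r with (/ (Rabs M + 1)); [apply Rinv_0_lt_compat; lra|].
      replace (d * (Rabs M + 1) * / (Rabs M + 1)) with d by (field; lra).
      unfold Rdiv in Hw2; lra. }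
    apply Rmult_le_reg_l with (r ^ 2); [nra|].
    replace (r ^ 2 * (d ^ 2 / r ^ 2 * M)) with (d * (d * M)) by (field; lra).
    replace (r ^ 2 * (eps * d)) with (d * (eps * r ^ 2)) by ring.
    apply Rmult_le_compat_l; [exact Hc|].
    apply (Rmult_le_compat_l d) in HMa; lra.
Qed.

Lemma ex_derive_Cpseries (a : nat -> R) (f : C -> C) (z : C) :
  is_Cpseries_fun a f -> Rbar_lt (Cmod z) (CV_radius a) ->
  @ex_derive C_AbsRing C_NormedModule f z.
Proof.
  intros Hf Hz.
  destruct (ex_Cpseries (PS_derive a) z) as [g Hg]; [now rewrite CV_radius_derive|].
  exists g; now apply (is_derive_Cpseries a).
Qed.

Lemma is_Cpseries_theta (a : nat -> R) (f : C -> C) :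
  is_Cpseries_fun a f -> is_Cpseries_fun (euler_coeff a) (theta f).
Proof.
  intros Hf z; rewrite CV_radius_euler; intros Hz.
  destruct (ex_Cpseries (PS_derive a) z) as [g Hg]; [now rewrite CV_radius_derive|].
  unfold theta.
  rewrite (is_C_derive_unique f z g) by now apply (is_derive_Cpseries a).
  eapply is_series_ext; [|exact (is_Cpseries_incr_1 _ _ _ Hg)].
  intros n; cbv beta; now rewrite euler_coeff_incr_derive.
Qed.

Lemma is_Cpseries_theta_iter (a : nat -> R) (f : C -> C) (j : nat) :
  is_Cpseries_fun a f ->
  is_Cpseries_fun (Nat.iter j euler_coeff a) (theta_iter j f).
Proof.
  intros Hf; induction j as [|j IH]; [exact Hf|].
  exact (is_Cpseries_theta _ _ IH).
Qed.

Lemma CV_radius_euler_iter (a : nat -> R) (j : nat) :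
  CV_radius (Nat.iter j euler_coeff a) = CV_radius a.
Proof.
  induction j as [|j IH]; [reflexivity|].
  simpl; now rewrite CV_radius_euler.
Qed.

Lemma euler_iter_eq (a : nat -> R) (j n : nat) :
  Nat.iter j euler_coeff a n = INR n ^ j * a n.
Proof.
  induction j as [|j IH]; simpl; [ring|].
  unfold euler_coeff at 1; rewrite IH; ring.
Qed.

(** * Harmonic numbers and the power series of [Pi_k1] *)

Lemma harmonic_0 : harmonic 0 = 0.
Proof. now apply (sum_n_m_zero (G := R_AbelianMonoid)); lia. Qed.

Lemma harmonic_S (n : nat) : harmonic (S n) = harmonic n + / INR (S n).
Proof. unfold harmonic; rewrite sum_n_Sm by lia; reflexivity. Qed.

Lemma harmonic_bounds (n : nat) : 0 <= harmonic n <= INR n.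
Proof.
  induction n as [|n IH]; [rewrite harmonic_0; simpl; lra|].
  assert (H : 1 <= INR (S n)) by (rewrite S_INR; assert (H := pos_INR n); lra).
  assert (H0 : 0 < / INR (S n)) by (apply Rinv_0_lt_compat; lra).
  assert (H1 : / INR (S n) <= 1) by (rewrite <- Rinv_1; apply Rinv_le_contravar; lra).
  rewrite harmonic_S, (S_INR n) in *; lra.
Qed.

(* At [n = 0, 1] truncated subtraction gives [harmonic 0 = 0], so the series
   effectively starts at the monomial of degree 2. *)
Definition Pi_coeff (k n : nat) : R :=
  (-1) ^ (n - 1) * harmonic (n - 1) / INR n ^ k.

(** Since [H_n <= n <= (n+1)^k], the coefficients are bounded by 1. *)
Lemma CV_radius_Pi_coeff (k : nat) :
  (1 <= k)%nat -> Rbar_le 1 (CV_radius (Pi_coeff k)).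
Proof.
  intros Hk.
  apply (proj1 (CV_radius_bounded (Pi_coeff k))).
  exists 1; intros n; rewrite pow1, Rmult_1_r; unfold Pi_coeff.
  destruct n as [|n].
  - simpl; rewrite harmonic_0; unfold Rdiv; rewrite Rmult_0_r, Rmult_0_l, Rabs_R0; lra.
  - replace (S n - 1)%nat with n by lia.
    assert (H : 1 <= INR (S n)) by (rewrite S_INR; assert (H := pos_INR n); lra).
    assert (Hp : INR (S n) <= INR (S n) ^ k).
    { rewrite <- (pow_1 (INR (S n))) at 1; now apply Rle_pow. }
    assert (Hh := harmonic_bounds n).
    unfold Rdiv; rewrite !Rabs_mult, pow_1_abs, Rmult_1_l.
    rewrite (Rabs_pos_eq (harmonic n)) by lra.
    rewrite Rabs_pos_eq by (left; apply Rinv_0_lt_compat; lra).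
    apply Rmult_le_reg_r with (INR (S n) ^ k); [lra|].
    rewrite Rmult_assoc, Rinv_l by lra.
    rewrite S_INR in Hp at 1; lra.
Qed.

Lemma Pi_series_term_sum (k : nat) (z s : C) :
  is_Cpseries (Pi_coeff k) z s -> is_Cseries (Pi_series_term k z) s.
Proof.
  assert (H01 : forall n, (n < 2)%nat -> Pi_coeff k n = 0).
  { intros n Hn; unfold Pi_coeff; replace (n - 1)%nat with 0%nat by lia.
    rewrite harmonic_0; unfold Rdiv; ring. }
  intros H.
  assert (H1 : is_Cseries (fun n => RtoC (Pi_coeff k (S n)) * z ^ S n)%C s).
  { apply (is_series_incr_1 (fun n => RtoC (Pi_coeff k n) * z ^ n)%C).
    match goal with |- is_series _ ?l => replace l with s end; [exact H|].
    rewrite H01 by lia; Cring. }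
  assert (H2 : is_Cseries (fun n => RtoC (Pi_coeff k (S (S n))) * z ^ S (S n))%C s).
  { apply (is_series_incr_1 (fun n => RtoC (Pi_coeff k (S n)) * z ^ S n)%C).
    match goal with |- is_series _ ?l => replace l with s end; [exact H1|].
    rewrite H01 by lia; Cring. }
  eapply is_series_ext; [|exact H2].
  intros n; unfold Pi_series_term, Pi_term, Pi_coeff.
  replace (S n + 1)%nat with (S (S n)) by lia.
  now replace (S (S n) - 1)%nat with (S n) by lia.
Qed.

Lemma Pi_k1_is_Cpseries (k : nat) : is_Cpseries_fun (Pi_coeff k) (Pi_k1 k).
Proof.
  intros z Hz.
  destruct (ex_Cpseries _ _ Hz) as [s Hs].
  replace (Pi_k1 k z) with s; [exact Hs|].
  assert (H := Pi_series_term_sum k z s Hs).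
  symmetry; apply (iota_unique (V := C_CompleteNormedModule)); [|exact H].
  intros t Ht; exact (is_Cseries_unique _ _ _ Ht H).
Qed.

(** * The differential equation on coefficients *)

(** This gives the coefficients of [theta^k Pi_k1]. At [n = 0], where cancelling the power may fail,
    both sides vanish because [harmonic 0 = 0]. *)
Lemma pow_mult_Pi_coeff (k n : nat) :
  INR n ^ k * Pi_coeff k n = (-1) ^ (n - 1) * harmonic (n - 1).
Proof.
  unfold Pi_coeff; destruct n as [|n].
  - simpl; rewrite harmonic_0; unfold Rdiv; ring.
  - field; apply pow_nonzero, not_0_INR; lia.
Qed.

(** Here [c i] lists the coefficients of [theta^(k+i) f]. Sorted by powers of [phi], the operator is
    [(theta^2 - 3 theta + 2) + phi (2 theta^2 - 3 theta + 1) + phi^2 theta^2] applied to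
    [theta^k f], and each factor [phi] becomes a shift [PS_incr_1]. *)
Lemma D_k1_Cpseries (a : nat -> R) (f : C -> C) (k : nat) (z : C) :
  is_Cpseries_fun a f -> Rbar_lt (Cmod z) (CV_radius a) ->
  let c := fun i n => INR n ^ i * (INR n ^ k * a n) in
  is_Cpseries
    (fun n => c 2%nat n - 3 * c 1%nat n + 2 * c 0%nat n
              + PS_incr_1 (fun n => 2 * c 2%nat n - 3 * c 1%nat n + c 0%nat n) n
              + PS_incr_1 (PS_incr_1 (c 2%nat)) n)
    z (D_k1 k f z).
Proof.
  intros Hf Hz c.
  assert (Hc : forall i, is_Cpseries (c i) z (theta_iter (k + i) f z)).
  { intros i.
    assert (H := is_Cpseries_theta_iter a f (k + i) Hf z).
    rewrite CV_radius_euler_iter in H.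
    eapply is_series_ext; [|exact (H Hz)].
    intros n; cbv beta; rewrite euler_iter_eq, pow_add; unfold c.
    do 2 f_equal; ring. }
  assert (H0 := Hc 0%nat); rewrite Nat.add_0_r in H0.
  assert (H1 := Hc 1%nat); assert (H2 := Hc 2%nat).
  set (s0 := theta_iter k f z) in *.
  set (s1 := theta_iter (k + 1) f z) in *.
  set (s2 := theta_iter (k + 2) f z) in *.
  replace (D_k1 k f z) with
    (s2 + RtoC (-3) * s1 + RtoC 2 * s0
     + z * (RtoC 2 * s2 + RtoC (-3) * s1 + s0) + z * (z * s2))%C
    by (unfold D_k1; fold s0 s1 s2; ring).
  assert (HA := is_Cpseries_plus _ _ _ _ _
    (is_Cpseries_plus _ _ _ _ _ H2 (is_Cpseries_scal (-3) _ _ _ H1))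
    (is_Cpseries_scal 2 _ _ _ H0)).
  assert (HB := is_Cpseries_incr_1 _ _ _ (is_Cpseries_plus _ _ _ _ _
    (is_Cpseries_plus _ _ _ _ _
      (is_Cpseries_scal 2 _ _ _ H2) (is_Cpseries_scal (-3) _ _ _ H1)) H0)).
  eapply is_series_ext;
    [|exact (is_Cpseries_plus _ _ _ _ _ (is_Cpseries_plus _ _ _ _ _ HA HB)
        (is_Cpseries_incr_1 _ _ _ (is_Cpseries_incr_1 _ _ _ H2)))].
  intros n; cbv beta; do 2 f_equal.
  destruct n; simpl; ring.
Qed.

Theorem lemma3p1 (k : nat) (hk : (2 <= k)%nat) :
    (forall phi : C, (Cmod phi < 1)%R ->
       @ex_series C_AbsRing C_NormedModule (Pi_series_term k phi)) /\
    (forall (j : nat) (phi : C), (j < k + 2)%nat -> (Cmod phi < 1)%R ->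
       @ex_derive C_AbsRing C_NormedModule (theta_iter j (Pi_k1 k)) phi) /\
    (forall phi : C, (Cmod phi < 1)%R ->
       D_k1 k (Pi_k1 k) phi = RtoC 0).
Proof.
  assert (Hdisc : forall phi : C, Cmod phi < 1 ->
            Rbar_lt (Cmod phi) (CV_radius (Pi_coeff k))).
  { intros phi Hphi; apply Rbar_lt_le_trans with 1; [exact Hphi|].
    apply CV_radius_Pi_coeff; lia. }
  assert (HPi := Pi_k1_is_Cpseries k).
  split; [|split].
  - intros phi Hphi; exists (Pi_k1 k phi).
    now apply Pi_series_term_sum, HPi, Hdisc.
  - intros j phi _ Hphi.
    apply ex_derive_Cpseries with (Nat.iter j euler_coeff (Pi_coeff k)).
    + now apply is_Cpseries_theta_iter.
    + rewrite CV_radius_euler_iter; now apply Hdisc.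
  - intros phi Hphi.
    refine (is_Cpseries_0 _ _ _ _ (D_k1_Cpseries _ _ k phi HPi (Hdisc phi Hphi))).
    (* For [n >= 3] the [n]-th coefficient is [(-1)^(n-1) (n - 2)] times
       [(n-1) (H_{n-1} - H_{n-2}) - (n-2) (H_{n-2} - H_{n-3}) = 1 - 1]. *)
    intros n.
    destruct n as [|[|[|m]]]; unfold PS_incr_1; rewrite ?pow_mult_Pi_coeff.
    + cbn [Nat.sub]; rewrite harmonic_0; unfold zero; simpl; ring.
    + cbn [Nat.sub]; rewrite harmonic_0; unfold zero; simpl; ring.
    + cbn [Nat.sub]; rewrite !harmonic_S, harmonic_0; simpl; field.
    + cbn [Nat.sub]; rewrite !harmonic_S, Nat.sub_0_r.
      assert (Hm := pos_INR m).
      rewrite !S_INR, <- !tech_pow_Rmult; simpl; field; lra.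
Qed.
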